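(* Let $\phi$ be a formula in the language of $\mathbf{FPT}$. The following are equivalent: (i) $\phi$ has the flatness property; (ii) $\phi$ is semantically equivalent to a classical formula (a formula built from $p_i,\neg p_i,\bot$ using $\wedge,\otimes$ only); (iii) $\phi$ has the downward closure property and the union closure property.
   Context: Fix propositional variables $p_i$, $i\in\mathbb{N}$. A valuation is a function $s:\mathbb{N}\to\{0,1\}$ (more generally on $N\subseteq\mathbb N$); a team is a set of valuations. Write $s(\vec i)$ for $\langle s(i_1),\dots,s(i_k)\rangle$. Formulas of the full propositional team logic $\mathbf{FPT}$: $\phi::=p_i\mid\neg p_i\mid\mathrm{NE}\mid\bot\mid p_{i_1}\dots p_{i_k}\perp p_{j_1}\dots p_{j_m}\mid{=}(p_{i_1},\dots,p_{i_k},p_j)\mid p_{i_1}\dots p_{i_k}\subseteq p_{j_1}\dots p_{j_k}\mid\phi\wedge\phi\mid\phi\otimes\phi\mid\phi\circledast\phi\mid\phi\vee\phi$. Semantics: $X\models p_i$ iff $s(i)=1$ for all $s\in X$; $X\models\neg p_i$ iff $s(i)=0$ for all $s\in X$; $X\models\bot$ iff $X=\emptyset$; $X\models\mathrm{NE}$ iff $X\neq\emptyset$; $X\models p_{\vec i}\perp p_{\vec j}$ iff for all $s,s'\in X$ there is $s''\in X$ with $s''(\vec i)=s(\vec i)$ and $s''(\vec j)=s'(\vec j)$; $X\models{=}(p_{\vec i},p_j)$ iff for all $s,s'\in X$, $s(\vec i)=s'(\vec i)$ implies $s(j)=s'(j)$; $X\models p_{\vec i}\subseteq p_{\vec j}$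 iff for all $s\in X$ there is $s'\in X$ with $s(\vec i)=s'(\vec j)$; $X\models\phi\wedge\psi$ iff both; $X\models\phi\otimes\psi$ iff $X=Y\cup Z$ for some $Y,Z\subseteq X$ with $Y\models\phi$, $Z\models\psi$; $X\models\phi\circledast\psi$ iff $X=\emptyset$ or $X=Y\cup Z$ for some nonempty $Y,Z$ with $Y\models\phi$, $Z\models\psi$; $X\models\phi\vee\psi$ iff $X\models\phi$ or $X\models\psi$. $\phi\equiv\psi$ means they are satisfied by the same teams. A formula $\phi$ has the flatness property if for all teams $X$: $X\models\phi\iff\{s\}\models\phi$ for all $s\in X$; the downward closure property if $X\models\phi$ and $Y\subseteq X$ imply $Y\models\phi$; the union closure property if whenever $X\models\phi$ for all $X\in\mathcal{X}$ (for any set $\mathcal X$ of teams) then $\bigcup\mathcal{X}\models\phi$. *)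

(* Defs.v *)
From mathcomp Require Import all_boot.
From mathcomp Require Import boolp classical_sets.

Set Implicit Arguments.
Unset Strict Implicit.
Unset Printing Implicit Defensive.

Local Open Scope classical_set_scope.

Definition valuation := nat -> bool.

Definition team := set valuation.

Definition vals (s : valuation) (i : seq nat) : seq bool := [seq s k | k <- i].

(* The sequences of variables in the atoms may be empty; for instance
   [Dep [::] j] is the constancy atom =(p_j). *)
Inductive FPT : Type :=
| Var of nat
| NegVar of nat
| NE
| Bot
| Indep of seq nat & seq nat
| Dep of seq nat & nat
| Incl (k : nat) of k.-tuple nat & k.-tuple nat
| And of FPT & FPT
| Tensor of FPT & FPT
| NeTensor of FPT & FPT
| Or of FPT & FPT.

Fixpoint sat (X : team) (phi : FPT) {struct phi} : Prop :=
  match phi with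
  | Var i => forall s, X s -> s i = true
  | NegVar i => forall s, X s -> s i = false
  | NE => X <> set0
  | Bot => X = set0
  | Indep i j => forall s s', X s -> X s' ->
      exists s'', [/\ X s'', vals s'' i = vals s i & vals s'' j = vals s' j]
  | Dep i j => forall s s', X s -> X s' -> vals s i = vals s' i -> s j = s' j
  | Incl k i j => forall s, X s -> exists s', X s' /\ vals s i = vals s' j
  | And phi1 phi2 => sat X phi1 /\ sat X phi2
  | Tensor phi1 phi2 => exists Y Z : team,
      [/\ Y `<=` X, Z `<=` X, X = Y `|` Z, sat Y phi1 & sat Z phi2]
  | NeTensor phi1 phi2 => X = set0 \/ exists Y Z : team,
      [/\ Y <> set0, Z <> set0, X = Y `|` Z, sat Y phi1 & sat Z phi2]
  | Or phi1 phi2 => sat X phi1 \/ sat X phi2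
  end.

Definition sem_equiv (phi psi : FPT) : Prop :=
  forall X : team, sat X phi <-> sat X psi.

Fixpoint classical (phi : FPT) : bool :=
  match phi with
  | Var _ | NegVar _ | Bot => true
  | And phi1 phi2 | Tensor phi1 phi2 => classical phi1 && classical phi2
  | _ => false
  end.

Definition flat (phi : FPT) : Prop :=
  forall X : team, sat X phi <-> (forall s, X s -> sat [set s] phi).

Definition downward_closed (phi : FPT) : Prop :=
  forall X Y : team, sat X phi -> Y `<=` X -> sat Y phi.

(* The family [XX] may be empty, so this entails [sat set0 phi]. *)
Definition union_closed (phi : FPT) : Prop :=
  forall XX : set team, (forall X, XX X -> sat X phi) ->
    sat (\bigcup_(X in XX) X) phi.

(* Main.v *)
From mathcomp Require Import all_boot.
From mathcomp Require Import boolp classical_sets.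
Require Import Defs.

Set Implicit Arguments.
Unset Strict Implicit.
Unset Printing Implicit Defensive.

Local Open Scope classical_set_scope.

(** A classical formula holds in a team iff it holds, under its Boolean reading
    ([Tensor] as disjunction), at every valuation of the team; hence it is flat.
    Conversely, a flat formula is determined by the set of valuations [s] with
    [sat [set s] phi]; this set depends only on the finitely many variables of
    [phi], so a classical formula defines it by Shannon expansion. Downward
    and union closure together amount to flatness because every team is the union
    of its singletons. *)

(** The last branch is the intended value for [Bot]; for the non-classical constructors it is a
    dummy. *)
Fixpoint holds (s : valuation) (psi : FPT) : bool :=
  match psi with
  | Var i => s i
  | NegVar i => ~~ s i
  | And psi1 psi2 => holds s psi1 && holds s psi2
  | Tensor psi1 psi2 => holds s psi1 || holds s psi2
  | _ => false
  end.

Lemma sat_classical (psi : FPT) : classical psi ->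
  forall X : team, sat X psi <-> (forall s, X s -> holds s psi).
Proof.
elim: psi => //= [i||psi1 IH1 psi2 IH2|psi1 IH1 psi2 IH2].
- by move=> _ X; split=> H s /H; [move=> ->|move/negbTE].
- by move=> _ X; split=> [->//|X0]; rewrite -subset0 => s /X0.
- case/andP=> /IH1{}IH1 /IH2{}IH2 X; rewrite IH1 IH2.
  split=> [[H1 H2] s Xs|H]; first by rewrite H1 // H2.
  by split=> s /H /andP[].
- case/andP=> /IH1{}IH1 /IH2{}IH2 X; split.
    move=> [Y [Z [_ _ -> /IH1 H1 /IH2 H2]]] s [/H1->//|/H2->].
    by rewrite orbT.
  (* Split [X] according to which disjunct holds; the two parts may overlap. *)
  move=> H; exists (X `&` [set s | holds s psi1]), (X `&` [set s | holds s psi2]).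
  split; [exact: subIsetl|exact: subIsetl| | |].
  + rewrite -setIUr; apply/esym/setIidl => s /H /orP.
    by case; [left|right].
  + by apply/IH1 => s [].
  + by apply/IH2 => s [].
Qed.

Lemma classical_flat (phi psi : FPT) :
  classical psi -> sem_equiv phi psi -> flat phi.
Proof.
move=> /sat_classical c e X; rewrite e c; split=> H s Xs.
  by rewrite e c => _ ->; exact: H.
by have /e/c := H s Xs; exact.
Qed.

Fixpoint vars (phi : FPT) : seq nat :=
  match phi with
  | Var i | NegVar i => [:: i]
  | NE | Bot => [::]
  | Indep i j => i ++ j
  | Dep i j => rcons i j
  | Incl k i j => i ++ j
  | And phi1 phi2 | Tensor phi1 phi2 | NeTensor phi1 phi2 | Or phi1 phi2 =>
      vars phi1 ++ vars phi2
  end.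

Lemma eq_vals (s t : valuation) (i : seq nat) :
  {in i, s =1 t} -> vals s i = vals t i.
Proof. by move/eq_in_map. Qed.

Lemma eq_in_catl (s t : valuation) (l m : seq nat) :
  {in l ++ m, s =1 t} -> {in l, s =1 t}.
Proof. by move=> E i il; apply: E; rewrite mem_cat il. Qed.

Lemma eq_in_catr (s t : valuation) (l m : seq nat) :
  {in l ++ m, s =1 t} -> {in m, s =1 t}.
Proof. by move=> E i im; apply: E; rewrite mem_cat im orbT. Qed.

(* The subteams of [[set s]] are [set0] and [[set s]], so locality on singletons
   goes through the two tensors without locality for arbitrary teams. *)
Lemma sat_set1_local (phi : FPT) (s t : valuation) :
  {in vars phi, s =1 t} -> sat [set s] phi -> sat [set t] phi.
Proof.
elim: phi => /= [i|i|||i j|i j|k i j|f IHf g IHg|f IHf g IHg|f IHf g IHg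
  |f IHf g IHg].
- by move=> E H _ ->; rewrite -E ?inE // H.
- by move=> E H _ ->; rewrite -E ?inE // H.
- by move=> _ _; apply/eqP/set0P; exists t.
- by move=> _ /seteqP[/(_ s erefl)].
- by move=> _ _ _ _ -> ->; exists t.
- by move=> _ _ _ _ -> ->.
- move=> E H _ ->; exists t; split=> //.
  have [_ [-> e]] := H s erefl.
  by rewrite -(eq_vals (eq_in_catl E)) -(eq_vals (eq_in_catr E)).
- move=> E [H1 H2]; split.
    by apply: IHf H1; exact: eq_in_catl E.
  by apply: IHg H2; exact: eq_in_catr E.
- move=> E [Y [Z [/subset_set1 HY /subset_set1 HZ e Hf Hg]]].
  have {}IHf := IHf (eq_in_catl E); have {}IHg := IHg (eq_in_catr E).
  (* Two empty halves cannot cover [[set s]]. In the other cases [[set t]] is split in the same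
     pattern, and an empty half is kept as it is. *)
  case: HY HZ => -> [] -> in e Hf Hg.
  + by move/seteqP: e => [/(_ s erefl) []].
  + exists set0, [set t]; split=> //; [by rewrite set0U|exact: IHg].
  + exists [set t], set0; split=> //; [by rewrite setU0|exact: IHf].
  + by exists [set t], [set t]; split=> //; [rewrite setUid|exact: IHf|exact: IHg].
- move=> E [/seteqP[/(_ s erefl)]//|[Y [Z [Y0 Z0 e Hf Hg]]]].
  have {}IHf := IHf (eq_in_catl E); have {}IHg := IHg (eq_in_catr E).
  (* A nonempty subteam of a singleton is the whole singleton, so both halves equal [[set s]]. *)
  have YX : Y `<=` [set s] by rewrite e; exact: subsetUl.
  have ZX : Z `<=` [set s] by rewrite e; exact: subsetUr.
  have t0 : [set t] <> set0 by move/seteqP=> [/(_ t erefl)].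
  case/subset_set1: YX => // eY; case/subset_set1: ZX => // eZ.
  right; exists [set t], [set t]; split=> //; first by rewrite setUid.
    by apply: IHf; rewrite -eY.
  by apply: IHg; rewrite -eZ.
- move=> E [H|H]; [left; apply: IHf H|right; apply: IHg H].
    exact: eq_in_catl E.
  exact: eq_in_catr E.
Qed.

Definition update (s : valuation) (v : nat) (b : bool) : valuation :=
  fun i => if i == v then b else s i.

Lemma update_id (s : valuation) (v : nat) : update s v (s v) = s.
Proof. by apply/funext => i; rewrite /update; case: eqP => // ->. Qed.

(** Induction on [l]: fixing the value of the head variable leaves two predicates that depend on the
    tail only. *)
Lemma classical_complete (l : seq nat) (P : valuation -> Prop) :
  (forall s t, {in l, s =1 t} -> P s -> P t) ->
  exists psi, classical psi /\ forall s, P s <-> holds s psi.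
Proof.
elim: l P => [|v l IH] P HP.
  have [[s Ps]|nP] := pselect (exists s, P s).
    (* With no variables left [P] is constant; excluded middle on [p_0] serves as truth. *)
    exists (Tensor (Var 0) (NegVar 0)); split=> // t /=.
    by rewrite orbN; split=> // _; exact: HP Ps.
  by exists Bot; split=> // s; split=> // Ps; case: nP; exists s.
have local b s t : {in l, s =1 t} -> P (update s v b) -> P (update t v b).
  move=> E; apply: HP => i; rewrite inE /update.
  by case: eqP => //= _ il; exact: E.
have [psi1 [c1 h1]] := IH _ (local true).
have [psi0 [c0 h0]] := IH _ (local false).
exists (Tensor (And (Var v) psi1) (And (NegVar v) psi0)).
split=> [|s] /=; first by rewrite c1 c0.
(* Only the [s] in [P s] is rewritten, so the case on [s v] selects the matching cofactor. *)
rewrite -{1}(update_id s v).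
by case: (s v); rewrite ?orbF /=; [exact: h1|exact: h0].
Qed.

Lemma flat_classical (phi : FPT) : flat phi ->
  exists psi, classical psi /\ sem_equiv phi psi.
Proof.
move=> F; have [psi [c h]] := classical_complete (@sat_set1_local phi).
exists psi; split=> // X; rewrite F (sat_classical c).
by split=> H s /H /h.
Qed.

Lemma flatP (phi : FPT) : flat phi <-> downward_closed phi /\ union_closed phi.
Proof.
split=> [F|[D U] X].
  split=> [X Y /F H YX|XX H]; first by apply/F => s /YX /H.
  by apply/F => s [X /H/F Xphi /Xphi].
split=> [H s Xs|H]; first by apply: D H _ => _ ->.
(* For empty [X] this is the union of the empty family. *)
have -> : X = \bigcup_(Y in [set [set s] | s in X]) Y.
  by rewrite bigcup_image bigcup_imset1 image_id.
by apply: U => _ [s Xs <-]; exact: H.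
Qed.

Theorem theorem3p2 (phi : FPT) :
  (flat phi <-> exists psi : FPT, classical psi = true /\ sem_equiv phi psi) /\
  ((exists psi : FPT, classical psi = true /\ sem_equiv phi psi) <->
   (downward_closed phi /\ union_closed phi)).
Proof.
have E : flat phi <-> exists psi, classical psi = true /\ sem_equiv phi psi.
  split=> [/flat_classical//|[psi [c e]]]; exact: classical_flat e.
by split=> //; rewrite -E; exact: flatP.
Qed.
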